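(* Every complete theory $U$ (i.e. for every sentence $B$ of its language, $U\vdash B$ or $U\vdash\neg B$) is Friedman-reflexive.
   Context: Theories are first-order theories in finite signature with arbitrary (not necessarily recursively enumerable) axiom sets, possibly inconsistent; interpretations may be multi-dimensional and piecewise; $V\rhd W$ means $V$ interprets $W$. A $U$-sentence $C$ is an interpreter of finitely axiomatised $A$ over $U$ iff for all $U$-sentences $B$: $(U+B)\rhd A$ iff $U+B\vdash C$; $U$ is Friedman-reflexive iff every finitely axiomatised $A$ has an interpreter over $U$. *)

(* Defs.v *)
From mathcomp Require Import all_boot.
From Stdlib Require List.

Set Implicit Arguments.
Unset Strict Implicit.
Unset Printing Implicit Defensive.

(* Finite first-order signatures. Identity is a logical symbol. *)
Record signature := Signature {
  fsym : finType;
  psym : finType;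
  far : fsym -> nat;
  par : psym -> nat }.

(* Variables are de Bruijn indices. *)
Inductive term (S : signature) : Type :=
| Var of nat
| Func (f : fsym S) of {ffun 'I_(far f) -> term S}.
Arguments Var {S} _.

Inductive form (S : signature) : Type :=
| Bot
| Eq of term S & term S
| Pred (P : psym S) of {ffun 'I_(par P) -> term S}
| Imp of form S & form S
| All of form S.
Arguments Bot {S}.

Section Syntax.
Variable S : signature.
Implicit Types (t : term S) (phi psi : form S) (sigma : nat -> term S).

Definition Neg phi := Imp phi Bot.
Definition Top : form S := Neg Bot.
Definition And phi psi := Neg (Imp phi (Neg psi)).
Definition Or phi psi := Imp (Neg phi) psi.
Definition Ex phi := Neg (All (Neg phi)).

Fixpoint subst_term sigma t : term S :=
  match t with
  | Var x => sigma x
  | Func f ts => Func [ffun i => subst_term sigma (ts i)]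
  end.

Definition shift : nat -> term S := fun x => Var x.+1.

Definition scons (T : Type) (a : T) (s : nat -> T) : nat -> T :=
  fun x => if x is y.+1 then s y else a.

Fixpoint subst sigma phi : form S :=
  match phi with
  | Bot => Bot
  | Eq s t => Eq (subst_term sigma s) (subst_term sigma t)
  | Pred P ts => Pred [ffun i => subst_term sigma (ts i)]
  | Imp phi psi => Imp (subst sigma phi) (subst sigma psi)
  | All phi => All (subst (scons (Var 0) (subst_term shift \o sigma)) phi)
  end.

Definition subst1 t phi : form S := subst (scons t Var) phi.

(* [bounded n phi]: all free variables of [phi] are among 0, ..., n - 1. *)
Fixpoint bounded_term n t : bool :=
  match t with
  | Var x => x < n
  | Func f ts => [forall i, bounded_term n (ts i)]
  end.

Fixpoint bounded n phi : bool :=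
  match phi with
  | Bot => true
  | Eq s t => bounded_term n s && bounded_term n t
  | Pred P ts => [forall i, bounded_term n (ts i)]
  | Imp phi psi => bounded n phi && bounded n psi
  | All phi => bounded n.+1 phi
  end.

(* Classical natural deduction with identity (nonempty domains). *)
Inductive prv : seq (form S) -> form S -> Prop :=
| prv_ax Gamma phi : List.In phi Gamma -> prv Gamma phi
| prv_impI Gamma phi psi : prv (phi :: Gamma) psi -> prv Gamma (Imp phi psi)
| prv_impE Gamma phi psi :
    prv Gamma (Imp phi psi) -> prv Gamma phi -> prv Gamma psi
| prv_contra Gamma phi : prv (Neg phi :: Gamma) Bot -> prv Gamma phi
| prv_allI Gamma phi :
    prv [seq subst shift psi | psi <- Gamma] phi -> prv Gamma (All phi)
| prv_allE Gamma phi t : prv Gamma (All phi) -> prv Gamma (subst1 t phi)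
| prv_eqI Gamma t : prv Gamma (Eq t t)
| prv_eqE Gamma phi s t :
    prv Gamma (Eq s t) -> prv Gamma (subst1 s phi) -> prv Gamma (subst1 t phi).

End Syntax.
Arguments Top {S}.

Record sentence (S : signature) := Sentence {
  sform :> form S;
  sform_closed : bounded 0 sform }.

(* A theory is an arbitrary set of sentences, its axioms. *)
Definition theory (S : signature) := sentence S -> Prop.

Definition provable (S : signature) (U : theory S) (phi : form S) : Prop :=
  exists Gamma : seq (sentence S),
    (forall psi, List.In psi Gamma -> U psi) /\
    prv [seq sform psi | psi <- Gamma] phi.

Definition extend (S : signature) (U : theory S) (B : sentence S) : theory S :=
  fun psi => U psi \/ psi = B.

Definition finitely_axiomatised (S : signature) (A : theory S) : Prop :=
  exists l : seq (sentence S), forall psi, A psi <-> List.In psi l.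

Definition complete (S : signature) (U : theory S) : Prop :=
  forall B : sentence S, provable U B \/ provable U (Neg B).

(* Multi-dimensional piecewise translations, without parameters, from the
   language of [S] into the language of [T], with at least one piece; pieces may
   have different dimensions. An object of piece [q] is
   represented by a block of [tdim q] objects of the target. Each symbol, and
   identity, gets one formula for every choice of pieces of its arguments; the
   free variables of that formula are the concatenation of the blocks of the
   arguments. A function symbol is translated as the graph of a function, the
   last block being that of the value. *)
Record translation (S T : signature) := Translation {
  npieces_pred : nat;
  tdim : 'I_npieces_pred.+1 -> nat;
  tdom : 'I_npieces_pred.+1 -> form T;
  teq : 'I_npieces_pred.+1 -> 'I_npieces_pred.+1 -> form T;
  tpred : psym S -> seq 'I_npieces_pred.+1 -> form T;
  tfun : fsym S -> seq 'I_npieces_pred.+1 -> 'I_npieces_pred.+1 -> form T;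
  tdomP : forall q, bounded (tdim q) (tdom q);
  teqP : forall p q, bounded (tdim p + tdim q) (teq p q);
  tpredP : forall P ps, size ps = par P ->
    bounded (sumn (map tdim ps)) (tpred P ps);
  tfunP : forall f ps q, size ps = far f ->
    bounded (sumn (map tdim ps) + tdim q) (tfun f ps q) }.

Arguments tdim {S T} _ _.
Arguments tdom {S T} _ _.
Arguments teq {S T} _ _ _.
Arguments tpred {S T} _ _ _.
Arguments tfun {S T} _ _ _ _.

Section Translate.
Variables (S T : signature) (tau : translation S T).

(* A piece together with the target variables forming a block of it. *)
Definition object : Type := 'I_(npieces_pred tau).+1 * seq nat.

Definition lift_object (d : nat) (o : object) : object :=
  (o.1, map (addn d) o.2).

Definition inst (phi : form T) (vs : seq nat) : form T :=
  subst (fun i => Var (nth 0 vs i)) phi.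

(* The block bound by a quantifier over piece [q]. *)
Definition new_object (q : 'I_(npieces_pred tau).+1) : object :=
  (q, iota 0 (tdim tau q)).

(* Quantification over the objects of the interpreted domain: the body is in
   the scope of [tdim tau q] new target quantifiers. *)
Definition all_object (body : 'I_(npieces_pred tau).+1 -> form T) : form T :=
  \big[@And T/Top]_q
    iter (tdim tau q) (@All T)
      (Imp (inst (tdom tau q) (iota 0 (tdim tau q))) (body q)).

Definition ex_object (body : 'I_(npieces_pred tau).+1 -> form T) : form T :=
  \big[@Or T/Bot]_q
    iter (tdim tau q) (@Ex T)
      (And (inst (tdom tau q) (iota 0 (tdim tau q))) (body q)).

(* Nested terms are unravelled: a formula about the value of [f(ts)] becomes
   "there is an object that is a value of [f] at [ts] and satisfies it";
   a variable denotes its own object. This is done in continuation-passing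
   style: the continuation receives the number of target quantifiers introduced
   so far, and the object(s), valid under these quantifiers. *)
Definition env := nat -> object.
Definition eval := env -> (nat -> object -> form T) -> form T.

Fixpoint eval_seq (gs : seq eval) (e : env) (k : nat -> seq object -> form T) :
    form T :=
  if gs is g :: gs' then
    g e (fun d o =>
      eval_seq gs' (lift_object d \o e) (fun d' os =>
        k (d' + d) (lift_object d' o :: os)))
  else k 0 [::].

Fixpoint eval_term (t : term S) : eval :=
  match t with
  | Var x => fun e k => k 0 (e x)
  | Func f ts => fun e k =>
      eval_seq [seq eval_term (ts i) | i <- enum 'I_(far f)] e (fun d os =>
        ex_object (fun q =>
          And (inst (tfun tau f (map fst os) q)
                 (flatten [seq (lift_object (tdim tau q) o).2 | o <- os]
                    ++ (new_object q).2))
              (k (tdim tau q + d) (new_object q))))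
  end.

Fixpoint translate (phi : form S) (e : env) : form T :=
  match phi with
  | Bot => Bot
  | Eq s t =>
      eval_term s e (fun d o =>
        eval_term t (lift_object d \o e) (fun d' o' =>
          inst (teq tau o.1 o'.1) ((lift_object d' o).2 ++ o'.2)))
  | Pred P ts =>
      eval_seq [seq eval_term (ts i) | i <- enum 'I_(par P)] e (fun _ os =>
        inst (tpred tau P (map fst os)) (flatten (map snd os)))
  | Imp phi psi => Imp (translate phi e) (translate psi e)
  | All phi =>
      all_object (fun q =>
        translate phi (scons (new_object q) (lift_object (tdim tau q) \o e)))
  end.

(* The environment is irrelevant since the sentence is closed. *)
Definition translate_sentence (phi : sentence S) : form T :=
  translate phi (fun _ => new_object ord0).

End Translate.

(* [interprets V W]: V interprets W. Quantifying over all theorems of [W] (not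
   only its axioms) covers the laws of identity, nonemptiness of the domain, and
   totality and functionality of the translated function symbols. *)
Definition interprets (T S : signature) (V : theory T) (W : theory S) : Prop :=
  exists tau : translation S T, forall phi : sentence S,
    provable W phi -> provable V (translate_sentence tau phi).

Definition interpreter (S S' : signature) (U : theory S) (A : theory S')
    (C : sentence S) : Prop :=
  forall B : sentence S,
    interprets (extend U B) A <-> provable (extend U B) C.

Definition Friedman_reflexive (S : signature) (U : theory S) : Prop :=
  forall (S' : signature) (A : theory S'), finitely_axiomatised A ->
    exists C : sentence S, interpreter U A C.

(* Main.v *)
Require Import Defs.
From mathcomp Require Import all_boot.
From Stdlib Require Import Classical.
From Stdlib Require List.

Set Implicit Arguments.
Unset Strict Implicit.
Unset Printing Implicit Defensive.

(* Over a complete theory U, each extension U + B either has the same theorems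
   as U or is inconsistent. So Top is an interpreter of A if U interprets A, and
   Bot is one otherwise. *)

(** Interpretability of [A] depends only on the theorems of the interpreting theory
    ([interprets_provable]), so it takes the same value at [U] and at each [U + B] with [U] proving
    [B], by [provable_cut]. The other extensions are inconsistent and interpret everything
    ([interprets_inconsistent]). A constant sentence can therefore record whether [U] interprets
    [A]. *)

Section Provability.
Variable S : signature.
Implicit Types (U V : theory S) (Gamma Delta : seq (form S)) (phi psi : form S).

Lemma prv_weaken Gamma Delta phi :
  List.incl Gamma Delta -> prv Gamma phi -> prv Delta phi.
Proof.
move=> sub pr; elim: pr Delta sub => {Gamma phi}.
- by move=> Gamma phi inG Delta sub; apply/prv_ax/sub.
- move=> Gamma phi psi _ IH Delta sub; apply/prv_impI/IH.
  by move=> chi /= [->|/sub inD]; [left | right].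
- move=> Gamma phi psi _ IH1 _ IH2 Delta sub.
  by apply: prv_impE (IH1 _ sub) (IH2 _ sub).
- move=> Gamma phi _ IH Delta sub; apply/prv_contra/IH.
  by move=> chi /= [->|/sub inD]; [left | right].
- move=> Gamma phi _ IH Delta sub; apply/prv_allI/IH.
  exact: List.incl_map.
- by move=> Gamma phi t _ IH Delta sub; apply/prv_allE/IH.
- by move=> Gamma t Delta _; apply: prv_eqI.
- move=> Gamma phi s t _ IH1 _ IH2 Delta sub.
  by apply: prv_eqE (IH1 _ sub) (IH2 _ sub).
Qed.

Lemma provable_ax U (psi : sentence S) : U psi -> provable U psi.
Proof.
move=> Upsi; exists [:: psi]; split; first by move=> _ /= [<-|[]].
by apply: prv_ax; left.
Qed.

Lemma provable_impE U phi psi :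
  provable U (Imp phi psi) -> provable U phi -> provable U psi.
Proof.
move=> [Gamma [UG pr1]] [Delta [UD pr2]]; exists (Gamma ++ Delta); split.
  by move=> chi /(@List.in_app_or _ Gamma Delta) [/UG|/UD].
rewrite map_cat; apply: (@prv_impE _ _ phi).
- by apply: prv_weaken pr1; apply: List.incl_appl.
- by apply: prv_weaken pr2; apply: List.incl_appr.
Qed.

(** Only finitely many axioms of [V] occur in a derivation; the deduction theorem discharges them
    one at a time, which is why the induction generalises over [phi]. *)
Lemma provable_cut U V phi :
  (forall psi : sentence S, V psi -> provable U psi) -> provable V phi -> provable U phi.
Proof.
move=> UV [Gamma [VG pr]].
elim: Gamma phi VG pr => [|psi Gamma IH] phi VG pr; first by exists [::].
apply: provable_impE (UV psi (VG psi (or_introl erefl))).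
by apply: IH (prv_impI pr) => chi inG; apply: VG; right.
Qed.

Lemma provable_extend U (B : sentence S) phi :
  provable U phi -> provable (extend U B) phi.
Proof. by apply: provable_cut => psi Upsi; apply: provable_ax; left. Qed.

Lemma provable_Top U : provable U Top.
Proof.
exists [::]; split=> //.
by apply/prv_impI/prv_ax; left.
Qed.

Lemma provable_explosion U phi : provable U Bot -> provable U phi.
Proof.
move=> [Gamma [UG pr]]; exists Gamma; split=> //.
by apply: prv_contra; apply: prv_weaken pr => chi; right.
Qed.

Lemma interprets_provable S' U V (A : theory S') :
  (forall phi, provable U phi -> provable V phi) ->
  interprets U A -> interprets V A.
Proof. by move=> UV [tau Utau]; exists tau => phi /Utau /UV. Qed.

Lemma interprets_inconsistent S' U (A : theory S') :
  provable U Bot -> interprets U A.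
Proof.
move=> UBot.
(* Any translation would do. This one has a single piece, of dimension 0, and only [Bot] as
   formulas, so the boundedness conditions hold by computation. *)
exists (@Translation S' S 0 (fun=> 0) (fun=> Bot) (fun _ _ => Bot)
  (fun _ _ => Bot) (fun _ _ _ => Bot) (fun=> erefl) (fun _ _ => erefl)
  (fun _ _ _ => erefl) (fun _ _ _ _ => erefl)) => phi _.
exact: provable_explosion.
Qed.

End Provability.

Theorem theorem6p1 (S : signature) (U : theory S) (hU : complete U) :
  Friedman_reflexive U.
Proof.
move=> S' A _; have [UA | nUA] := classic (interprets U A).
  exists (@Sentence S Top erefl) => B; split=> _; first exact: provable_Top.
  by apply: interprets_provable UA => phi; apply: provable_extend.
exists (@Sentence S Bot erefl) => B; split; last exact: interprets_inconsistent.
move=> UBA; have [UB | UnB] := hU B.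
  (* If [U] proves [B], it proves all theorems of [U + B], so it would itself interpret [A]. *)
  case: nUA; apply: interprets_provable UBA => phi.
  by apply: provable_cut => psi [/provable_ax|->].
(* If [U] refutes [B], then [U + B] proves [Bot], the chosen interpreter. *)
apply: provable_impE (provable_extend B UnB) _.
by apply: provable_ax; right.
Qed.
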